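(* Let $(X,\zeta)_\xi$ and $(X',\zeta')_\xi$ be soft topological spaces with the same parameter set $\xi$, and let $\varrho\colon X\to X'$ be a function such that $(\mathbb{I}_\xi,\varrho)\colon (X,\zeta)_\xi\to (X',\zeta')_\xi$ is a soft continuous mapping. If $(X,\zeta)_\xi$ is soft connected, then $\varrho(X)$ is soft connected, i.e. the soft subspace $(\varrho(X),\zeta'_{\varrho(X)})_\xi$ of $(X',\zeta')_\xi$ is soft connected.
   Context: A soft set over a set $X$ with parameter set $\xi$ is a function $W\colon\xi\to\mathcal{P}(X)$. Soft union, soft intersection, soft complement ($W^c(e)=X\setminus W(e)$) and soft inclusion $\widetilde{\sqsubseteq}$ of soft sets with parameter set $\xi$ are taken parameterwise. For $A\subseteq X$, the absolute soft subset $A_\xi$ is the soft set with $A_\xi(e)=A$ for all $e\in\xi$; in particular $\emptyset_\xi$ and $X_\xi$ are the soft empty set and the absolute soft set. For $x\in X$, $x\,\widetilde{\in}\,W$ means $x\in W(e)$ for every $e\in\xi$. A soft topology $\zeta$ on $X$ with parameter set $\xi$ is a collection of soft sets over $X$ (with parameter set $\xi$) containing $\emptyset_\xi$ and $X_\xi$ and closed under arbitrary soft unions and under soft intersections of two members; $(X,\zeta)_\xi$ is a soft topological space and members of $\zeta$ are soft open. A soft open neighborhood of $x$ is a $W\in\zeta$ with $x\,\widetilde{\in}\,W$. For $A\subseteq X$, the soft subspace $(A,\zeta_A)_\xi$ has $\zeta_A=\{W_A: W\in\zeta\}$, $W_A(e)=W(e)\cap A$. For a function $\varrho\colon X\to X'$,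 put $\varrho(W)(e)=\varrho(W(e))$. The mapping $(\mathbb{I}_\xi,\varrho)\colon(X,\zeta)_\xi\to(X',\zeta')_\xi$ (with $\mathbb{I}_\xi$ the identity of $\xi$) is soft continuous if for every $x\in X$ and every soft open neighborhood $W'$ of $\varrho(x)$ there is a soft open neighborhood $W$ of $x$ with $\varrho(W)\,\widetilde{\sqsubseteq}\,W'$. $(X,\zeta)_\xi$ is soft disconnected if there are nonempty $A,B\subseteq X$ with $A\cup B=X$, $A\cap B=\emptyset$ and both $A_\xi$ and $B_\xi$ soft open; otherwise it is soft connected. A subset $A\subseteq X$ is soft connected if $(A,\zeta_A)_\xi$ is soft connected. *)

(* Defs.v *)
From mathcomp Require Import all_boot.
From mathcomp Require Import boolp classical_sets.

Set Implicit Arguments.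
Unset Strict Implicit.
Unset Printing Implicit Defensive.

Local Open Scope classical_set_scope.

Definition soft_set (X xi : Type) := xi -> set X.

Section SoftSets.
Context {X xi : Type}.
Implicit Types (W V : soft_set X xi) (F : set (soft_set X xi)).

Definition absolute (A : set X) : soft_set X xi := fun=> A.

Definition soft_bigcup F : soft_set X xi := fun e => \bigcup_(W in F) W e.

Definition soft_inter W V : soft_set X xi := fun e => W e `&` V e.

Definition soft_subset W V : Prop := forall e, W e `<=` V e.

Definition soft_mem (x : X) W : Prop := forall e, W e x.

End SoftSets.

Record soft_topology (X xi : Type) := SoftTopology {
  soft_open : set (soft_set X xi);
  soft_open0 : soft_open (absolute set0);
  soft_openT : soft_open (absolute setT);
  soft_open_bigcup : forall F : set (soft_set X xi),
    F `<=` soft_open -> soft_open (soft_bigcup F);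
  soft_openI : forall W V : soft_set X xi,
    soft_open W -> soft_open V -> soft_open (soft_inter W V)
}.

Definition soft_open_nbhd {X xi : Type} (zeta : soft_topology X xi) (x : X)
    (W : soft_set X xi) : Prop :=
  soft_open zeta W /\ soft_mem x W.

Definition soft_image {X X' xi : Type} (rho : X -> X') (W : soft_set X xi) :
  soft_set X' xi := fun e => rho @` W e.

(* Continuity of the soft mapping (id, rho): both spaces share the parameter
   set xi. *)
Definition soft_continuous {X X' xi : Type} (zeta : soft_topology X xi)
    (zeta' : soft_topology X' xi) (rho : X -> X') : Prop :=
  forall (x : X) (W' : soft_set X' xi), soft_open_nbhd zeta' (rho x) W' ->
    exists2 W : soft_set X xi, soft_open_nbhd zeta x W
                             & soft_subset (soft_image rho W) W'.

Definition soft_disconnected {X xi : Type} (zeta : soft_topology X xi) : Prop :=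
  exists A B : set X,
    [/\ A !=set0 /\ B !=set0, A `|` B = setT, A `&` B = set0,
        soft_open zeta (absolute A) & soft_open zeta (absolute B)].

Definition soft_connected {X xi : Type} (zeta : soft_topology X xi) : Prop :=
  ~ soft_disconnected zeta.

(* The soft set e |-> W e `&` A, as a soft set over the subtype A of X. *)
Definition soft_restrict {X xi : Type} (A : set X) (W : soft_set X xi) :
  soft_set A xi := fun e => [set x : A | W e (val x)].
Arguments soft_restrict {X xi} A W.

Lemma soft_restrictE {X xi : Type} (A : set X) (W : soft_set X xi) (e : xi) :
  val @` soft_restrict A W e = W e `&` A.
Proof.
apply/seteqP; split=> [_ [x Wx <-]|x [Wx Ax]]; first by split=> //; exact: set_valP.
by exists (exist _ x (mem_set Ax)).
Qed.

Section SoftSubspace.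
Context {X xi : Type} (zeta : soft_topology X xi) (A : set X).

Definition soft_subspace_open : set (soft_set A xi) :=
  [set soft_restrict A W | W in soft_open zeta].

Lemma soft_subspace_open0 : soft_subspace_open (absolute set0).
Proof. by exists (absolute set0); [exact: soft_open0|]. Qed.

Lemma soft_subspace_openT : soft_subspace_open (absolute setT).
Proof. by exists (absolute setT); [exact: soft_openT|]. Qed.

Lemma soft_subspace_open_bigcup (F : set (soft_set A xi)) :
  F `<=` soft_subspace_open -> soft_subspace_open (soft_bigcup F).
Proof.
move=> FO; exists (soft_bigcup [set W | soft_open zeta W /\ F (soft_restrict A W)]).
  by apply: soft_open_bigcup => W [].
apply/funext => e; apply/seteqP; split=> x /=.
  by move=> [W [_ FW] Wx]; exists (soft_restrict A W).
move=> [V FV Vx]; have [W oW WV] := FO _ FV.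
by exists W; [split=> //; rewrite WV|rewrite -WV in Vx].
Qed.

Lemma soft_subspace_openI (W V : soft_set A xi) :
  soft_subspace_open W -> soft_subspace_open V ->
  soft_subspace_open (soft_inter W V).
Proof.
move=> [W' oW' <-] [V' oV' <-]; exists (soft_inter W' V') => //.
exact: soft_openI.
Qed.

Definition soft_subspace : soft_topology A xi :=
  SoftTopology soft_subspace_open0 soft_subspace_openT
    soft_subspace_open_bigcup soft_subspace_openI.

End SoftSubspace.

Definition soft_connected_subset {X xi : Type} (zeta : soft_topology X xi)
    (A : set X) : Prop :=
  soft_connected (soft_subspace zeta A).

(* Main.v *)
Require Import Defs.
From mathcomp Require Import all_boot.
From mathcomp Require Import boolp classical_sets.

(** A soft disconnection of the subspace on [range rho] pulls back along [rho]
to a soft disconnection of the source.  Pulling back is the delicate step: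
soft continuity is a pointwise condition, and a point is a soft member of [W]
only if it lies in [W e] for all parameters [e] simultaneously, so preimages of
general soft open sets need not be soft open.  The preimage of an absolute
soft set is again absolute, however, and for absolute sets being a soft
neighbourhood of each of their points does imply being soft open
([soft_open_absolute_local]); hence preimages of soft open absolute sets are
soft open ([soft_continuous_preimage_absolute]).  A continuous surjection
therefore preserves connectedness ([soft_connected_surjective]), and the
theorem is the case of [rho] corestricted to its range. *)

Local Open Scope classical_set_scope.

(** The union of all soft open sets inside [absolute P] is [absolute P] itself,
since each point of [P] belongs at every parameter to its neighbourhood.  This
uses that all the fibres of [absolute P] coincide; for a soft set with varying
fibres, a point of a single fibre need not be a soft member. *)
Lemma soft_open_absolute_local (X xi : Type) (zeta : soft_topology X xi)
    (P : set X) :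
  (forall x, P x ->
    exists2 W, soft_open_nbhd zeta x W & soft_subset W (absolute P)) ->
  soft_open zeta (absolute P).
Proof.
move=> nbhdP.
have -> : absolute P =
    soft_bigcup [set W | soft_open zeta W /\ soft_subset W (absolute P)].
  apply/funext => e; apply/seteqP; split=> x.
    by move=> /nbhdP[W [oW xW] WP]; exists W; [split|exact: xW].
  by move=> [W [_ WP] Wx]; exact: (WP e).
by apply: soft_open_bigcup => W [].
Qed.

Lemma soft_continuous_preimage_absolute (X X' xi : Type)
    (zeta : soft_topology X xi) (zeta' : soft_topology X' xi) (rho : X -> X')
    (A : set X') :
  soft_continuous zeta zeta' rho -> soft_open zeta' (absolute A) ->
  soft_open zeta (absolute (rho @^-1` A)).
Proof.
move=> rho_cont oA; apply: soft_open_absolute_local => x Ax.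
have [|W nbhdW WA] := rho_cont x (absolute A); first by split=> // e.
by exists W => // e y Wy; apply: (WA e); exists y.
Qed.

(** Surjectivity keeps the preimages of the two parts nonempty; the remaining
conditions on a disconnection commute with any preimage. *)
Lemma soft_connected_surjective (X X' xi : Type)
    (zeta : soft_topology X xi) (zeta' : soft_topology X' xi) (rho : X -> X') :
  (forall y, exists x, rho x = y) -> soft_continuous zeta zeta' rho ->
  soft_connected zeta -> soft_connected zeta'.
Proof.
move=> surj rho_cont conn [A [B [[[a Aa] [b Bb]] AUB AIB oA oB]]].
apply: conn; exists (rho @^-1` A), (rho @^-1` B); split.
- have [x xa] := surj a; have [y yb] := surj b.
  by split; [exists x; rewrite /preimage/= xa|exists y; rewrite /preimage/= yb].
- by rewrite -preimage_setU AUB preimage_setT.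
- by rewrite -preimage_setI AIB preimage_set0.
- exact: soft_continuous_preimage_absolute rho_cont oA.
- exact: soft_continuous_preimage_absolute rho_cont oB.
Qed.

Definition corestrict {X X' : Type} (rho : X -> X') (x : X) : range rho :=
  exist _ (rho x) (mem_set (imageT rho x)).

Lemma corestrict_surjective (X X' : Type) (rho : X -> X') (y : range rho) :
  exists x, corestrict rho x = y.
Proof. by have [x _ rhox] := set_valP y; exists x; exact: val_inj. Qed.

Lemma soft_continuous_corestrict (X X' xi : Type)
    (zeta : soft_topology X xi) (zeta' : soft_topology X' xi) (rho : X -> X') :
  soft_continuous zeta zeta' rho ->
  soft_continuous zeta (soft_subspace zeta' (range rho)) (corestrict rho).
Proof.
move=> rho_cont x _ [[W' oW' <-] xW'].
have [|W nbhdW WW'] := rho_cont x W'; first by split.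
by exists W => // e _ [y Wy <-]; apply: (WW' e); exists y.
Qed.

Theorem theorem3p5 (X X' xi : Type) (zeta : soft_topology X xi)
    (zeta' : soft_topology X' xi) (rho : X -> X')
    (rho_cont : soft_continuous zeta zeta' rho)
    (X_conn : soft_connected zeta) :
  soft_connected_subset zeta' (range rho).
Proof.
apply: soft_connected_surjective X_conn; first exact: corestrict_surjective.
exact: soft_continuous_corestrict.
Qed.
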